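(* Let $(R,\mathfrak m,k)$ be a noetherian commutative complete local ring of prime characteristic $p$. Assume that the residue field $k$ is separably closed and that $\operatorname{depth}(R)\geq 3$. Then $\widetilde{H}_0(\Delta(R);k)=\widetilde{H}_1(\Delta(R);k)=0$.
   Context: For a noetherian commutative local ring $R$ with maximal ideal $\mathfrak m$ and minimal primes $\mathfrak p_1,\dots,\mathfrak p_n$, $\Delta(R)$ is the simplicial complex on the vertex set $\{1,\dots,n\}$ in which a subset $\{i_0,\dots,i_s\}$ is a face if and only if $\sqrt{\mathfrak p_{i_0}+\cdots+\mathfrak p_{i_s}}\neq\mathfrak m$. $\widetilde{H}_j(\Delta(R);k)$ denotes the $j$-th reduced (simplicial/singular) homology of $\Delta(R)$ with coefficients in $k$. *)

(* Defs.v *)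
From HB Require Import structures.
From mathcomp Require Import all_boot all_order all_algebra all_field.
Set Implicit Arguments. Unset Strict Implicit. Unset Printing Implicit Defensive.
Import Order.TTheory GRing.Theory Num.Theory.
Local Open Scope ring_scope.

Section Ideals.
Variable R : comNzRingType.

Definition same_set (I J : R -> Prop) := forall x, I x <-> J x.
Definition subset_of (I J : R -> Prop) := forall x, I x -> J x.

Definition is_ideal (I : R -> Prop) :=
  [/\ I 0, (forall x y, I x -> I y -> I (x - y)) & (forall r x, I x -> I (r * x))].

Definition is_prime_ideal (I : R -> Prop) :=
  [/\ is_ideal I, ~ I 1 & forall x y, I (x * y) -> I x \/ I y].

Definition is_maximal_ideal (I : R -> Prop) :=
  [/\ is_ideal I, ~ I 1 &
      forall J, is_ideal J -> subset_of I J -> same_set J I \/ J 1].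

Definition is_local_with (m : R -> Prop) :=
  is_maximal_ideal m /\ forall J, is_maximal_ideal J -> same_set J m.

Definition is_minimal_prime (P : R -> Prop) :=
  is_prime_ideal P /\ forall Q, is_prime_ideal Q -> subset_of Q P -> same_set Q P.

Definition generated_by (s : seq R) (x : R) :=
  exists c : 'I_(size s) -> R, x = \sum_(i < size s) c i * s`_i.

Definition noetherian := forall I, is_ideal I -> exists s, same_set I (generated_by s).

Definition ideal_mul (I J : R -> Prop) (x : R) :=
  exists s : seq (R * R),
    (forall q, q \in s -> I q.1 /\ J q.2) /\ x = \sum_(q <- s) q.1 * q.2.

Fixpoint ideal_pow (I : R -> Prop) (k : nat) : R -> Prop :=
  match k with
  | 0 => fun _ => True
  | k'.+1 => ideal_mul I (ideal_pow I k')
  end.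

(* m-adically complete (and separated): R -> lim R/m^k is an isomorphism *)
Definition madic_complete (m : R -> Prop) :=
  (forall x, (forall k, ideal_pow m k x) -> x = 0) /\
  (forall a : nat -> R,
     (forall k, exists N, forall i j, (N <= i)%N -> (N <= j)%N -> ideal_pow m k (a i - a j)) ->
     exists l, forall k, exists N, forall i, (N <= i)%N -> ideal_pow m k (a i - l)).

Definition regular_seq (s : seq R) :=
  ~ generated_by s 1 /\
  forall i, (i < size s)%N -> forall r,
      generated_by (take i s) (r * s`_i) -> generated_by (take i s) r.

Definition depth_ge (m : R -> Prop) (d : nat) :=
  exists s : seq R, size s = d /\ (forall x, x \in s -> m x) /\ regular_seq s.

Definition radical (I : R -> Prop) (x : R) := exists e : nat, I (x ^+ e).

Definition ideal_sum n (P : 'I_n -> R -> Prop) (F : {set 'I_n}) (x : R) :=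
  exists f : 'I_n -> R, (forall i, i \in F -> P i (f i)) /\ x = \sum_(i in F) f i.

(* Delta(R) as a simplicial complex on 'I_n, including the empty face
   (needed for reduced homology) *)
Definition Delta n (m : R -> Prop) (P : 'I_n -> R -> Prop) (F : {set 'I_n}) : Prop :=
  F = set0 \/ ~ same_set (radical (ideal_sum P F)) m.

End Ideals.

Definition separably_closed (k : fieldType) :=
  forall p : {poly k}, (1 < size p)%N -> separable_poly p -> exists x, root p x.

(* Reduced simplicial homology with coefficients in a field k.
   A j-chain is supported on faces with j+1 vertices (the empty face is the
   (-1)-simplex); boundary uses the standard signs. *)
Section Homology.
Variables (k : fieldType) (n : nat) (K : {set 'I_n} -> Prop).

Definition is_chain (j : nat) (c : {ffun {set 'I_n} -> k}) :=
  forall F, c F != 0 -> K F /\ #|F| = j.+1.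

Definition boundary (c : {ffun {set 'I_n} -> k}) : {ffun {set 'I_n} -> k} :=
  [ffun G : {set 'I_n} => \sum_(v in ~: G) (-1) ^+ #|[set i in G | (nat_of_ord i < nat_of_ord v)%N]| * c (v |: G)].

Definition reduced_homology_zero (j : nat) :=
  forall c, is_chain j c -> boundary c = 0 ->
    exists d, is_chain j.+1 d /\ boundary d = c.

End Homology.

(* Main.v *)
Require Import Defs.
From mathcomp Require Import all_boot all_order all_algebra all_field.
From mathcomp Require classical_sets.
From mathcomp Require Import boolp ring zify.
Set Implicit Arguments. Unset Strict Implicit. Unset Printing Implicit Defensive.
Import GRing.Theory.
Local Open Scope ring_scope.

(** Write [U] for the punctured spectrum of [R] and [H^i] for the cohomology of
    its structure sheaf. A 1-cocycle of [Delta(R)] with values in [F_p] glues the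
    components [V(P_i)] to an [F_p]-torsor over [U], trivial on the open set
    [U_S = U \ \bigcup_(i notin S) V(P_i)] for each face [S], so it becomes a
    Cech cocycle of constants. Depth at least 3 gives [H^1 = 0], hence
    functions [h_S] on [U_S] whose differences are these constants. The functions
    [h_S^p - h_S] agree on overlaps and, as [H^0 = R], come from some [r] in [R];
    since [R] is complete with separably closed residue field, [r = v^p - v].
    Then [h_S - v] is a root of [T^p - T], i.e. locally constant with values in
    [F_p], and this writes the cocycle as a coboundary. In degree 0 the same
    argument with constants in place of [h_S] gives the connectedness of
    [Delta(R)]. Homology over [k] vanishes because cohomology over [F_p] does.

    Sections over [U_S] are handled as fractions [u a / g a], with finitely many
    [g a] vanishing on the [V(P_i)], [i notin S a], and generating an ideal whose
    radical contains the elements of interest. *)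

(** * Ideals *)

Section IdealTheory.
Variable R : comNzRingType.
Implicit Types (I J : R -> Prop) (x y z r s t : R).

Lemma ideal0 I : is_ideal I -> I 0. Proof. by case. Qed.

Lemma idealB I x y : is_ideal I -> I x -> I y -> I (x - y).
Proof. by case=> _ H _; apply: H. Qed.

Lemma idealMl I r x : is_ideal I -> I x -> I (r * x).
Proof. by case=> _ _; apply. Qed.

Lemma idealMr I r x : is_ideal I -> I x -> I (x * r).
Proof. by move=> idI Ix; rewrite mulrC; apply: idealMl. Qed.

Lemma idealN I x : is_ideal I -> I x -> I (- x).
Proof. by move=> idI Ix; rewrite -sub0r; apply: idealB => //; apply: ideal0. Qed.

Lemma idealD I x y : is_ideal I -> I x -> I y -> I (x + y).
Proof. by move=> idI Ix Iy; rewrite -[y]opprK; apply: idealB => //; apply: idealN. Qed.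

Lemma ideal_bigsum (T : Type) (l : seq T) (Q : pred T) (F : T -> R) I :
  is_ideal I -> (forall a, Q a -> I (F a)) -> I (\sum_(a <- l | Q a) F a).
Proof.
move=> idI IF; elim/big_rec: _ => [|a x Qa Ix]; first exact: ideal0.
by apply: idealD => //; apply: IF.
Qed.

Lemma ideal_exp I x e d : is_ideal I -> (e <= d)%N -> I (x ^+ e) -> I (x ^+ d).
Proof. by move=> idI le_ed Ix; rewrite -(subnKC le_ed) exprD; apply: idealMr. Qed.

Lemma ideal_principal x : is_ideal (fun r => exists t, r = x * t).
Proof.
split; first by exists 0; rewrite mulr0.
  by move=> _ _ [s ->] [t ->]; exists (s - t); rewrite mulrBr.
by move=> r _ [t ->]; exists (r * t); ring.
Qed.

Lemma ideal_zero : is_ideal (fun r : R => r = 0).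
Proof.
split=> [//|x y -> ->|r x ->]; first by rewrite subr0.
by rewrite mulr0.
Qed.

Lemma prime_exp I x e : is_prime_ideal I -> I (x ^+ e) -> I x.
Proof.
case=> idI I1 Imul; elim: e => [/I1 //|e IHe].
by rewrite exprS => /Imul[].
Qed.

Lemma prime_bigprod (T : Type) (l : seq T) (Q : pred T) (F : T -> R) I :
  is_prime_ideal I -> I (\prod_(a <- l | Q a) F a) -> exists2 a, Q a & I (F a).
Proof.
case=> idI I1 Imul; elim/big_rec: _ => [/I1 //|a x Qa IHx].
by case/Imul => [?|/IHx]; first by exists a.
Qed.

Definition span (A : finType) (g : A -> R) x := exists c : A -> R, x = \sum_a c a * g a.

Lemma span_ideal (A : finType) (g : A -> R) : is_ideal (span g).
Proof.
split.
- by exists (fun=> 0); rewrite big1 // => a _; rewrite mul0r.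
- move=> _ _ [r ->] [s ->]; exists (fun a => r a - s a).
  by rewrite -sumrB; apply: eq_bigr => a _; rewrite mulrBl.
- move=> t _ [r ->]; exists (fun a => t * r a).
  by rewrite mulr_sumr; apply: eq_bigr => a _; rewrite mulrA.
Qed.

Lemma span_mem (A : finType) (g : A -> R) a : span g (g a).
Proof.
exists (fun b => (b == a)%:R); rewrite (bigD1 a) //= eqxx mul1r big1 ?addr0 //.
by move=> b /negPf->; rewrite mul0r.
Qed.

Lemma ideal_sumP n (P : 'I_n -> R -> Prop) F :
  (forall i, is_ideal (P i)) -> is_ideal (ideal_sum P F).
Proof.
move=> idP; split.
- exists (fun=> 0); split; last by rewrite big1.
  by move=> i _; apply: ideal0.
- move=> _ _ [f [Pf ->]] [g [Pg ->]]; exists (fun i => f i - g i); split.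
    by move=> i Fi; apply: idealB => //; [apply: Pf|apply: Pg].
  by rewrite sumrB.
- move=> r _ [f [Pf ->]]; exists (fun i => r * f i); split.
    by move=> i Fi; apply: idealMl => //; apply: Pf.
  by rewrite mulr_sumr.
Qed.

Lemma ideal_sum_mem n (P : 'I_n -> R -> Prop) (F : {set 'I_n}) i x :
  (forall i, is_ideal (P i)) -> i \in F -> P i x -> ideal_sum P F x.
Proof.
move=> idP Fi Px; exists (fun j => if j == i then x else 0); split.
  by move=> j Fj; case: eqP => [->//|_]; apply: ideal0.
rewrite (bigD1 i) //= eqxx big1 ?addr0 // => j /andP[_ /negPf->] //.
Qed.

Lemma ideal_sum_sub n (P : 'I_n -> R -> Prop) (F : {set 'I_n}) J x :
  is_ideal J -> (forall i y, i \in F -> P i y -> J y) -> ideal_sum P F x -> J x.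
Proof.
by move=> idJ PJ [f [Pf ->]]; apply: ideal_bigsum => // i Fi; apply: PJ (Pf i Fi).
Qed.

(** Each binomial term contains [u ^+ d] or [v ^+ e], since its exponents add up to [d + e]. *)
Lemma mul_expB_eq0 s t u v d e :
  s * u ^+ d = 0 -> t * v ^+ e = 0 -> s * t * (u - v) ^+ (d + e) = 0.
Proof.
move=> sud tve; rewrite exprBn mulr_sumr big1 // => i _.
have [le_ei|lt_ie] := leqP e i.
  rewrite -(subnK le_ei) [v ^+ _]exprD.
  have -> a b c : s * t * ((a * b * (c * v ^+ e)) *+ 'C(d + e, i - e + e)) =
     (t * v ^+ e) * (s * a * b * c) *+ 'C(d + e, i - e + e) by rewrite -mulrnAr; ring.
  by rewrite tve mul0r mul0rn.
rewrite -addnBA ?exprD; last exact: ltnW.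
have -> a b c : s * t * ((a * (u ^+ d * b) * c) *+ 'C(d + e, i)) =
   (s * u ^+ d) * (t * a * b * c) *+ 'C(d + e, i) by rewrite -mulrnAr; ring.
by rewrite sud mul0r mul0rn.
Qed.

(* If [f] is not nilpotent, the complement of a maximal multiplicative set
   containing [f] and avoiding [0] is a minimal prime. *)
Lemma minimal_prime_avoiding (f : R) :
  (forall e, f ^+ e != 0) -> exists2 Q, is_minimal_prime Q & ~ Q f.
Proof.
move=> f_nil.
(* Containing [1] and [f] is required only of inhabited sets, so that the union of the empty chain
   also qualifies in Zorn's lemma. *)
pose mult (S : R -> Prop) := [/\ ~ S 0, forall x y, S x -> S y -> S (x * y)
   & forall x, S x -> S 1 /\ S f].
have mult_pow : mult (fun x => exists e, x = f ^+ e).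
  split=> [[e /esym/eqP]|x y [d ->] [e ->]|x _]; first by rewrite (negPf (f_nil e)).
    by exists (d + e)%N; rewrite exprD.
  by split; [exists 0%N|exists 1%N].
have [|S [multS maxS]] := @classical_sets.Zorn_bigcup R mult.
  move=> F multF totF; split.
  - by case=> S FS; case: (multF _ FS).
  - move=> x y [S FS Sx] [T FT Ty]; case: (totF _ _ FS FT) => sub.
      by exists T => //; case: (multF _ FT) => _ H _; apply: H => //; apply: sub.
    by exists S => //; case: (multF _ FS) => _ H _; apply: H => //; apply: sub.
  - by move=> x [S FS Sx]; case: (multF _ FS) => _ _ /(_ x Sx)[]; split; exists S.
have [S0 SM S1f] := multS.
have [x Sx] : exists x, S x.
  apply: contrapT => noS; apply: (maxS _ _ mult_pow); split.
    by move=> x Sx; case: noS; exists x.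
  by move/(_ f) => /= H; case: noS; exists f; apply: H; exists 1%N.
have [S1 Sf] := S1f x Sx.
have outS u : ~ S u -> exists s e, S s /\ s * u ^+ e = 0.
  move=> Su; apply: contrapT => nosu.
  (* [T] is generated by [S] and [u]; if it avoided [0], it would contradict maximality. *)
  pose T : R -> Prop := fun x => exists s e, S s /\ x = s * u ^+ e.
  apply: (maxS T); first split.
  - by move=> s Ss; exists s, 0%N; rewrite expr0 mulr1.
  - by move/(_ u) => H; apply/Su/H; exists 1, 1%N; rewrite mul1r.
  - split.
    + by case=> s [e [Ss /esym sue]]; apply: nosu; exists s, e.
    + move=> _ _ [s [d [Ss ->]]] [t [e [St ->]]]; exists (s * t), (d + e)%N.
      by split; [apply: (SM)|rewrite exprD; ring].
    + by move=> _ _; split; [exists 1, 0%N|exists f, 0%N]; rewrite ?mulr1.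
have prS : is_prime_ideal (fun x => ~ S x).
  split; last 1 first.
  - by move=> u v Suv; case: (EM (S u)) => Su; [right=> Sv; apply/Suv/SM|left].
  - split=> // [u v /outS[s [d [Ss sud]]] /outS[t [e [St tve]]] Suv|r u].
      have: S (s * t * (u - v) ^+ (d + e)).
        apply: (SM); first exact: (SM).
        by elim: (d + e)%N => [|k IHk] //; rewrite exprS; apply: (SM).
      by rewrite mul_expB_eq0.
    move=> /outS[s [e [Ss sue]]] Sru; apply: S0.
    suff <- : s * (r * u) ^+ e = 0.
      apply: (SM) => //; elim: e {sue} => [|e IHe] //.
      by rewrite exprS; apply: (SM).
    by rewrite exprMn mulrCA sue mulr0.
  - by apply.
exists (fun x => ~ S x); last by [].
split=> // Q [idQ Q1 QM] subQ y; split=> [|Sy]; first exact: subQ.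
(* The complement of a strictly smaller prime would be a strictly larger multiplicative set. *)
apply: contrapT => Qy; apply: (maxS (fun x => ~ Q x)).
  split; first by move=> z Sz Qz; apply: (subQ z).
  by move/(_ y Qy).
split; first by apply; apply: ideal0.
  by move=> a b Qa Qb /QM[].
by move=> a Qa; split => // Qf; apply: (subQ f).
Qed.

End IdealTheory.

(** * Cech cohomology with respect to a regular sequence *)

Section Cech.
Variable R : comNzRingType.
Implicit Types (x y z r s t : R).

Definition reg3 x y z :=
  [/\ forall r, x * r = 0 -> r = 0,
      forall r s, y * r = x * s -> exists t, r = x * t &
      forall r s t, z * r = x * s + y * t -> exists s' t', r = x * s' + y * t'].

(** [R/x^(k+1)] is an extension of [R/x] by [R/x^k]: a relation is first solved modulo [x], then [x]
    is cancelled and induction applies. *)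
Lemma reg3_expx x y z k : reg3 x y z -> reg3 (x ^+ k) y z.
Proof.
move=> [nzx nzy nzz]; split.
- by elim: k => [|k IHk] r; rewrite ?mul1r // exprS -mulrA => /nzx/IHk.
- elim: k => [|k IHk] r s yr; first by exists r; rewrite mul1r.
  have [r' def_r] : exists r', r = x * r'.
    by apply: (nzy r (x ^+ k * s)); rewrite yr exprS; ring.
  have [|t def_r'] := IHk r' s.
    apply/eqP; rewrite -subr_eq0; apply/eqP/nzx; move: yr; rewrite def_r exprS.
    by move/eqP; rewrite -subr_eq0 => /eqP <-; ring.
  by exists t; rewrite def_r def_r' exprS mulrA.
- elim: k => [|k IHk] r s t zr; first by exists r, 0; ring.
  have [r' [t' def_r]] : exists r' t', r = x * r' + y * t'.
    by apply: (nzz r (x ^+ k * s) t); rewrite zr exprS; ring.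
  have xu : x * (z * r' - x ^+ k * s) = y * (t - z * t').
    move: zr; rewrite def_r exprS => /eqP; rewrite -subr_eq0 => /eqP H.
    by apply/eqP; rewrite -subr_eq0 -H; apply/eqP; ring.
  have [v def_v] := nzy _ _ (esym xu).
  have [|a [b def_r']] := IHk r' s v.
    apply/eqP; rewrite -subr_eq0; apply/eqP/nzx.
    by move/eqP: xu; rewrite def_v -subr_eq0 => /eqP <-; ring.
  by exists a, (x * b + t'); rewrite def_r def_r' exprS; ring.
Qed.

Lemma reg3_expy x y z k : reg3 x y z -> reg3 x (y ^+ k) z.
Proof.
move=> [nzx nzy nzz]; split=> //.
- elim: k => [|k IHk] r s yr; first by exists s; rewrite -yr mul1r.
  by have [|t /IHk] := nzy (y ^+ k * r) s; rewrite // -yr exprS mulrA.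
- elim: k => [|k IHk] r s t zr; first by exists 0, r; ring.
  have [s' [r' def_r]] : exists s' r', r = x * s' + y * r'.
    by apply: (nzz r s (y ^+ k * t)); rewrite zr exprS; ring.
  have [|v def_v] := nzy (z * r' - y ^+ k * t) (s - z * s').
    move: zr; rewrite def_r exprS => /eqP; rewrite -subr_eq0 => /eqP H.
    by apply/eqP; rewrite -subr_eq0 -H; apply/eqP; ring.
  have [|a [b def_r']] := IHk r' v t; first by rewrite -def_v; ring.
  by exists (s' + y * a), b; rewrite def_r def_r' exprS; ring.
Qed.

Lemma reg3_expz x y z k : reg3 x y z -> reg3 x y (z ^+ k).
Proof.
move=> [nzx nzy nzz]; split=> //.
elim: k => [|k IHk] r s t zr; first by exists s, t; rewrite -zr mul1r.
by have [|a [b /IHk]] := nzz (z ^+ k * r) s t; rewrite // -zr exprS mulrA.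
Qed.

(** Powers are needed because a cover generates an ideal containing the regular sequence only up to
    radical. *)
Lemma reg3_exp x y z a b c : reg3 x y z -> reg3 (x ^+ a) (y ^+ b) (z ^+ c).
Proof. by move=> reg; apply/reg3_expx/reg3_expy/reg3_expz. Qed.

Lemma depth_ge3 (m : R -> Prop) :
  depth_ge m 3 -> exists x y z, [/\ m x, m y, m z & reg3 x y z].
Proof.
case=> s [sz_s [ms [_ regs]]]; case: s sz_s ms regs => [|x [|y [|z [|]]]] //= _ ms regs.
exists x, y, z; split; try by apply: ms; rewrite !inE eqxx ?orbT.
have gen_nil r : generated_by [::] r -> r = 0 by case=> c ->; rewrite big_ord0.
split=> [r xr|r s yr|r s t zr].
- apply: gen_nil; apply: (regs 0%N) => //=.
  by exists (fun=> 0); rewrite big_ord0 mulrC.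
- have [|c] := regs 1%N isT r.
    by exists (fun=> s); rewrite big_ord1 /= mulrC yr mulrC.
  by rewrite big_ord1 /= => ->; exists (c ord0); rewrite mulrC.
- have [|c] := regs 2%N isT r.
    exists (fun i => if val i == 0%N then s else t).
    by rewrite big_ord_recl big_ord1 /= mulrC zr; ring.
  by rewrite big_ord_recl big_ord1 /= => ->; eexists; eexists; rewrite 2!(mulrC (c _)).
Qed.

Variable A : finType.
Implicit Types (g u V G : A -> R).

(* [V a / G a] is a section of [R/I] over the open set [G a != 0]; these glue to
   a global section because [I, X, Y] behaves like a regular sequence. *)
Lemma cech_H0 (I : R -> Prop) V G X Y :
    is_ideal I -> span G X -> span G Y ->
    (forall r, I (X * r) -> I r) ->
    (forall r s, I (Y * r - X * s) -> exists t, I (r - X * t)) ->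
    (forall a b, I (V a * G b - V b * G a)) ->
  exists r, forall a, I (V a - r * G a).
Proof.
move=> idI [rX defX] [rY defY] nzX nzY glue.
(* Weighting the numerators [V b] by the coefficients of [Z] gives a numerator of the global section
   over the denominator [Z]. *)
have approx Z c : Z = \sum_a c a * G a ->
    forall a, I (G a * (\sum_b c b * V b) - Z * V a).
  move=> -> a; rewrite mulr_sumr mulr_suml -sumrB; apply: ideal_bigsum => // b _.
  have -> : G a * (c b * V b) - c b * G b * V a = c b * (V b * G a - V a * G b) by ring.
  exact: idealMl.
move: (\sum_b rX b * V b) (approx _ _ defX) => TX TXP.
move: (\sum_b rY b * V b) (approx _ _ defY) => TY TYP.
(* [TX / X] and [TY / Y] are the same section, so [X] divides [TX] modulo [I]; the quotient is
   [r]. *)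
have [|r Ir] := nzY TX TY.
  apply: nzX; rewrite {1}defX mulr_suml; apply: ideal_bigsum => // a _.
  have -> : rX a * G a * (Y * TX - X * TY) =
     rX a * (Y * (G a * TX - X * V a) - X * (G a * TY - Y * V a)) by ring.
  by apply: idealMl => //; apply: idealB => //; apply: idealMl.
exists r => a; apply: nzX.
have -> : X * (V a - r * G a) = G a * (TX - X * r) - (G a * TX - X * V a) by ring.
by apply: idealB => //; apply: idealMl.
Qed.

(* Multiplication by [X] is injective on [H^1] of the punctured spectrum since
   global sections lift from [R/X], and [X] kills the class of [c]. *)
Lemma cech_H1 (c : A -> A -> R) g X Y Z :
    reg3 X Y Z -> span g X -> span g Y -> span g Z ->
    (forall a b d, g a * g b * g d * (c a b + c b d - c a d) = 0) ->
  exists u, forall a b, u a * g b - u b * g a = c a b * g a * g b.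
Proof.
move=> [nzX nzY nzZ] [rX defX] gY gZ cocy.
(* The usual contracting homotopy, with [X = \sum_b rX b * g b] in place of a partition of unity;
   its boundary is therefore [X] times [c]. *)
pose H a := \sum_b rX b * g b * c a b.
have XH a b : g a * H a * g b - g b * H b * g a = X * (c a b * g a * g b).
  rewrite /H defX !(mulr_sumr, mulr_suml) -sumrB; apply: eq_bigr => d _.
  apply/eqP; rewrite -subr_eq0; apply/eqP.
  by rewrite -[RHS](mulr0 (- rX d)) -(cocy a b d); ring.
have [|||r defr] := @cech_H0 (fun r => exists t, r = X * t) (fun a => g a * H a) g Y Z
    (ideal_principal X) gY gZ.
- by move=> r [t]; apply: nzY.
- move=> r s [t def_t]; have [|a [b ->]] := nzZ r t s.
    by rewrite -def_t; ring.
  by exists b, a; ring.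
- by move=> a b; exists (c a b * g a * g b); rewrite XH.
have [u defu] := fin_all_exists defr.
(* Modulo [X] the [H a] glue to [r], and [u a] is the quotient of [g a * (H a - r)] by [X]. *)
exists u => a b; apply/eqP; rewrite -subr_eq0; apply/eqP/nzX.
by rewrite mulrBr -XH mulrBr !mulrA -!defu; ring.
Qed.

End Cech.

(** * Frobenius and Artin-Schreier equations *)

Section CharP.
Variables (p : nat) (R : comNzRingType).
Hypothesis pcharR : p \in [pchar R].
Implicit Types (x y r s w g : R) (I Q m : R -> Prop).

Let p_pr : prime p. Proof. exact: pcharf_prime pcharR. Qed.

Lemma Fp_expp (c : 'F_p) : c ^+ p = c.
Proof. by have := expf_card c; rewrite card_Fp. Qed.

Lemma pFrobenius_sum (T : finType) (F : T -> R) e :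
  (\sum_a F a) ^+ (p ^ e) = \sum_a F a ^+ (p ^ e).
Proof.
have p_nat : [pchar R].-nat (p ^ e)%N by rewrite pnatX pnatE ?pcharR.
apply: (big_morph (fun x => x ^+ (p ^ e))) => [x y|]; first exact: exprDn_pchar.
by rewrite expr0n expn_eq0 eqn0Ngt prime_gt0.
Qed.

Lemma exprB_pchar x y e : (x - y) ^+ (p ^ e) = x ^+ (p ^ e) - y ^+ (p ^ e).
Proof.
have p_nat : [pchar R].-nat (p ^ e)%N by rewrite pnatX pnatE ?pcharR.
by apply/eqP; rewrite eq_sym subr_eq -exprDn_pchar // subrK.
Qed.

Lemma span_exp_pchar (A : finType) (g : A -> R) x e :
  span g x -> span (fun a => g a ^+ (p ^ e)) (x ^+ (p ^ e)).
Proof.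
case=> c ->; exists (fun a => c a ^+ (p ^ e)).
by rewrite pFrobenius_sum; apply: eq_bigr => a _; rewrite exprMn.
Qed.

(** Exponents are enlarged to powers of [p] because raising to such a power is additive. *)
Lemma expn_dominates (T : finType) (d : T -> nat) : exists e, forall a, (d a <= p ^ e)%N.
Proof.
exists (\max_a d a)%N => a; apply: leq_trans (ltnW (ltn_expl _ (prime_gt1 p_pr))).
exact: leq_bigmax.
Qed.

Lemma radical_span (A : finType) (g : A -> R) I x :
  is_ideal I -> (forall a, radical I (g a)) -> span g x -> radical I x.
Proof.
move=> idI /fin_all_exists[d Id] gx; have [e le_de] := expn_dominates d.
exists (p ^ e)%N; have [c ->] := span_exp_pchar e gx.
apply: ideal_bigsum => // a _; apply: idealMl => //.
exact: ideal_exp (le_de a) (Id a).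
Qed.

(** The factorization of [T^p - T] over [F_p], homogenized by [g]. It is proved in [F_p[X][T]],
    where roots may be counted because [F_p[X]] is a domain, and then specialized at [X = g],
    [T = w]. *)
Lemma prod_sub_Fp (iota : {rmorphism 'F_p -> R}) w g :
  \prod_c (w - iota c * g) = w ^+ p - w * g ^+ p.-1.
Proof.
pose L : {poly {poly 'F_p}} := \prod_(c <- enum 'F_p) ('X - (c *: 'X)%:P).
pose M : {poly {poly 'F_p}} := 'X^p - 'X * ('X ^+ p.-1)%:P.
have card_p : #|'F_p| = p by apply: card_Fp.
have sizeL : size L = p.+1 by rewrite size_prod_XsubC -cardE card_p.
have monL : L \is monic by apply: monic_prod_XsubC.
have eqLM : L = M.
  (* Both sides are monic of degree [p], so their difference has degree less than [p], yet it has
     the [p] roots [c *: 'X]. *)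
  apply/eqP; rewrite -subr_eq0; apply: contraT => nzLM.
  have := @max_poly_roots _ _ [seq c *: 'X | c : 'F_p] nzLM.
  rewrite size_map -cardE card_p ltnNge => noroots.
  have [] : [/\ all (root (L - M)) [seq c *: 'X | c : 'F_p],
    uniq [seq c *: ('X : {poly 'F_p}) | c : 'F_p] & (size (L - M)%R <= p)%N]; last first.
    by move=> rs us sz; move/negP: (noroots rs us).
  split.
  - apply/allP => _ /mapP[c _ ->]; rewrite /root !hornerE.
    rewrite /L big_enum horner_prod (bigD1 c) //= !hornerE subrr mul0r sub0r oppr_eq0.
    rewrite exprZn Fp_expp -scalerAl -exprS.
    by rewrite prednK ?prime_gt0 // subrr.
  - rewrite map_inj_uniq ?enum_uniq // => c d /(congr1 (fun q : {poly 'F_p} => q`_1)).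
    by rewrite !coefZ coefX !mulr1.
  - apply/leq_sizeP => j le_pj; rewrite !coefB coefXn.
    have -> : ('X * ('X ^+ p.-1)%:P : {poly {poly 'F_p}})`_j = 0.
      rewrite coefXM; case: j le_pj => [|j] le_pj //=.
      by rewrite coefC; case: j le_pj => [|j] //; have := prime_gt1 p_pr; lia.
    have [-> | nejp] := eqVneq j p; last first.
      by rewrite nth_default ?sizeL ?subr0 ?subrr // ltn_neqAle eq_sym nejp.
    by move/monicP: monL; rewrite lead_coefE sizeL /= => ->; rewrite !subr0 subrr.
have comm_g : commr_rmorph iota g by move=> c; apply: mulrC.
have /(congr1 (fun q => (map_poly (horner_morph comm_g) q).[w])) := eqLM.
rewrite /L /M big_enum rmorph_prod horner_prod rmorphB rmorphM /= map_polyXn map_polyX map_polyC /=.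
rewrite !hornerE rmorphXn /= horner_morphX => <-; apply: eq_bigr => c _.
rewrite rmorphB /= map_polyX map_polyC !hornerE /= -mul_polyC rmorphM /=.
by rewrite horner_morphX horner_morphC.
Qed.

Lemma prime_Fp_ratio (iota : {rmorphism 'F_p -> R}) Q w g :
  is_prime_ideal Q -> Q (w ^+ p - w * g ^+ p.-1) -> exists c, Q (w - iota c * g).
Proof. by move=> prQ; rewrite -(prod_sub_Fp iota) => /(prime_bigprod prQ)[c]; exists c. Qed.

Lemma rmorph_Fp_exp (iota : {rmorphism 'F_p -> R}) c : iota c ^+ p = iota c.
Proof. by rewrite -rmorphXn /= Fp_expp. Qed.

Lemma ideal_Fp_scale (iota : {rmorphism 'F_p -> R}) I c x :
  is_ideal I -> c != 0 -> I (iota c * x) -> I x.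
Proof.
move=> idI nzc /(idealMl (iota c^-1) idI).
by rewrite mulrA -rmorphM mulVf // rmorph1 mul1r.
Qed.

End CharP.

(** * Convergent series in an [m]-adically complete ring *)

Section Complete.
Variables (R : comNzRingType) (m : R -> Prop).
Hypotheses (idm : is_ideal m) (complete_m : madic_complete m).
Implicit Types (x y r s : R).

Lemma ideal_pow_ideal k : is_ideal (ideal_pow m k).
Proof.
case: k => [|k] //=; split.
- by exists [::]; split; [|rewrite big_nil].
- move=> _ _ [s [ms ->]] [t [mt ->]].
  exists (s ++ [seq (- q.1, q.2) | q <- t]); split=> [q|].
    rewrite mem_cat => /orP[/ms //|/mapP[q' /mt[mq mkq] ->]]; split=> //=.
    exact: idealN.
  rewrite big_cat big_map /= -sumrN; congr (_ + _).
  by apply: eq_bigr => q _; rewrite mulNr.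
- move=> r _ [s [ms ->]]; exists [seq (r * q.1, q.2) | q <- s]; split=> [q|].
    by case/mapP=> q' /ms[mq mkq] ->; split=> //=; apply: idealMl.
  by rewrite big_map mulr_sumr; apply: eq_bigr => q _; rewrite mulrA.
Qed.

Lemma ideal_powM k x y : m x -> ideal_pow m k y -> ideal_pow m k.+1 (x * y).
Proof.
move=> mx mky; exists [:: (x, y)]; split; last by rewrite big_seq1.
by move=> q; rewrite inE => /eqP->.
Qed.

Lemma ideal_pow_exp k n x : m x -> (k <= n)%N -> ideal_pow m k (x ^+ n).
Proof.
move=> mx; elim: k n => [|k IHk] [|n] // le_kn.
by rewrite exprS; apply: ideal_powM => //; apply: IHk.
Qed.

Lemma ideal_pow_sum_cvg (b : nat -> R) :
    (forall k n, (k <= n)%N -> ideal_pow m k (b n)) ->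
  exists l, forall k, exists n, (k <= n)%N /\ ideal_pow m k (\sum_(i < n) b i - l).
Proof.
move=> mb; have idk := ideal_pow_ideal; have [_] := complete_m.
have tail k n : (k <= n)%N -> ideal_pow m k (\sum_(i < n) b i - \sum_(i < k) b i).
  move=> le_kn; rewrite -!(big_mkord xpredT b) (big_cat_nat (leq0n k) le_kn) /= addrAC subrr add0r.
  by rewrite big_nat_cond; apply: ideal_bigsum => // i /andP[/andP[/mb]].
case/(_ (fun n => \sum_(i < n) b i)) => [k|l cvg_l].
  exists k => i j /tail mi /tail mj.
  have -> a c : a - c = (a - \sum_(i < k) b i) - (c - \sum_(i < k) b i) by ring.
  exact: idealB.
exists l => k; have [N mN] := cvg_l k; exists (maxn k N).
by rewrite leq_maxl; split=> //; apply: mN; apply: leq_maxr.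
Qed.

Lemma ideal_pow_separated x : (forall k, ideal_pow m k x) -> x = 0.
Proof. by have [sep _] := complete_m; apply: sep. Qed.

(** The inverse is the sum of the geometric series. *)
Lemma sub1_invertible s : m s -> exists l, (1 - s) * l = 1.
Proof.
move=> ms; have [k n le_kn|l cvg_l] := @ideal_pow_sum_cvg (fun n => s ^+ n).
  exact: ideal_pow_exp.
exists l; apply/eqP; rewrite -subr_eq0; apply/eqP/ideal_pow_separated => k.
have [n [le_kn mk]] := cvg_l k; have idk := ideal_pow_ideal k.
have -> : (1 - s) * l - 1 = - ((1 - s) * (\sum_(i < n) s ^+ i - l)) - s ^+ n.
  have -> : (1 - s) * (\sum_(i < n) s ^+ i - l) = 1 - s ^+ n - (1 - s) * l.
    by rewrite mulrBr -[1 - s]opprB mulNr -subrX1 !opprB.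
  by ring.
apply: idealB => //; last exact: ideal_pow_exp.
by apply: idealN => //; apply: idealMl.
Qed.

Section ArtinSchreier.
Variables (p : nat) (k : fieldType) (pi : {rmorphism R -> k}).
Hypothesis pcharR : p \in [pchar R].

Let p_pr : prime p. Proof. exact: pcharf_prime pcharR. Qed.

(** The series [- (s + s^p + s^(p^2) + ...)] converges, and Frobenius makes [v ^+ p - v]
    telescope. *)
Lemma artin_schreier_max s : m s -> exists v, v ^+ p - v = s.
Proof.
move=> ms; have [j n le_jn|l cvg_l] := @ideal_pow_sum_cvg (fun n => s ^+ (p ^ n)).
  apply: ideal_pow_exp => //; apply: leq_trans le_jn _.
  exact: ltnW (ltn_expl _ (prime_gt1 p_pr)).
exists (- l); apply/eqP; rewrite -subr_eq0; apply/eqP/ideal_pow_separated => j.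
have [n [le_jn mj]] := cvg_l j; have idj := ideal_pow_ideal j.
move: mj; set a := \sum_(i < n) _ => mj.
have ap : a ^+ p - a = s ^+ (p ^ n) - s.
  have -> : a ^+ p = \sum_(i < n) s ^+ (p ^ i.+1).
    have := pFrobenius_sum pcharR (fun i : 'I_n => s ^+ (p ^ i)) 1.
    by rewrite expn1 => ->; apply: eq_bigr => i _; rewrite -exprM -expnSr.
  rewrite /a.
  elim: n {le_jn mj a} => [|n IHn]; first by rewrite !big_ord0 expr1 !subrr.
  by rewrite !big_ord_recr /= opprD addrACA IHn addrC addrA subrK.
have alp : (a - l) ^+ p = a ^+ p - l ^+ p by have := exprB_pchar pcharR a l 1; rewrite expn1.
have Nlp : (- l) ^+ p = - l ^+ p.
  have := exprB_pchar pcharR 0 l 1.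
  by rewrite expn1 !sub0r expr0n eqn0Ngt prime_gt0 // sub0r.
have -> : (- l) ^+ p - - l - s = (a - l) ^+ p - (a - l) - s ^+ (p ^ n).
  rewrite alp Nlp; have -> : s ^+ (p ^ n) = a ^+ p - a + s by rewrite ap subrK.
  by ring.
apply: idealB => //; last first.
  apply: ideal_pow_exp => //; apply: leq_trans le_jn _.
  exact: ltnW (ltn_expl _ (prime_gt1 p_pr)).
apply: idealB => //; rewrite -(prednK (prime_gt0 p_pr)) exprS.
exact: idealMr.
Qed.

(** The polynomial [T^p - T - r] has derivative [-1], hence is separable and has a root in [k].
    Lifting that root leaves an error in [m], which a convergent series absorbs by additivity of
    [v ^+ p - v]. *)
Lemma artin_schreier r :
    (forall y : k, exists x, pi x = y) -> (forall x, pi x = 0 <-> m x) ->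
  separably_closed k -> exists v, v ^+ p - v = r.
Proof.
move=> pi_surj pi_ker sepk.
pose q : {poly k} := 'X^p - 'X - (pi r)%:P.
have size_q : size q = p.+1.
  rewrite /q -addrA size_polyDl ?size_polyXn // ltnS.
  have szX : (size (- 'X : {poly k}) <= p)%N by rewrite size_polyN size_polyX prime_gt1.
  apply: leq_trans (size_polyD _ _) _; rewrite geq_max szX size_polyN.
  by rewrite (leq_trans (size_polyC_leq1 _)) ?prime_gt0.
have pchark : p \in [pchar k] by apply: rmorph_pchar pcharR.
have sep_q : separable_poly q.
  rewrite separable_poly.unlock /q !derivB derivXn derivX derivC subr0.
  have -> : 'X^(p.-1) *+ p = 0 :> {poly k}.
    by rewrite -mulr_natr -polyC_natr (pcharf0 pchark) mulr0.
  rewrite sub0r; have -> : -1 = (-1) *: 1 :> {poly k} by rewrite scaleN1r.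
  by rewrite coprimepZr ?coprimep1 ?oppr_eq0 ?oner_eq0.
have [|y] := sepk q _ sep_q; first by rewrite size_q ltnS prime_gt0.
rewrite /root /q !hornerE subr_eq0 => /eqP rooty.
have [u piu] := pi_surj y.
have [|v vP] := @artin_schreier_max (r - (u ^+ p - u)).
  by apply/pi_ker; rewrite !rmorphB rmorphXn /= piu rooty subrr.
exists (v + u).
rewrite exprDn_pchar ?pnatE //.
have -> : r = (v ^+ p - v) + (u ^+ p - u) by rewrite vP subrK.
by ring.
Qed.

End ArtinSchreier.
End Complete.

(** * Cohomology of the dual complex over F_p *)

Section DualComplex.
Variables (p : nat) (R : comNzRingType) (m : R -> Prop).
Variables (k : fieldType) (pi : {rmorphism R -> k}).
Variables (n : nat) (P : 'I_n -> R -> Prop) (iota : {rmorphism 'F_p -> R}).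
Hypothesis pcharR : p \in [pchar R].
Hypothesis idm : is_ideal m.
Hypothesis complete_m : madic_complete m.
Hypothesis pi_surj : forall y : k, exists x, pi x = y.
Hypothesis pi_ker : forall x, pi x = 0 <-> m x.
Hypothesis sepk : separably_closed k.
Hypothesis minP : forall i, is_minimal_prime (P i).
Hypothesis allP : forall Q, is_minimal_prime Q -> exists i, same_set Q (P i).
Hypothesis depthR : depth_ge m 3.

Implicit Types (x y f : R) (F G S T : {set 'I_n}).

Let p_pr : prime p. Proof. exact: pcharf_prime pcharR. Qed.
Let primeP i : is_prime_ideal (P i). Proof. by case: (minP i). Qed.
Let idP i : is_ideal (P i). Proof. by case: (primeP i). Qed.
Let idsum F : is_ideal (ideal_sum P F). Proof. exact: ideal_sumP. Qed.

Lemma max_prime : is_prime_ideal m.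
Proof.
split=> // [/pi_ker/eqP|x y /pi_ker/eqP]; first by rewrite rmorph1 oner_eq0.
by rewrite rmorphM mulf_eq0 => /orP[] /eqP/pi_ker; [left|right].
Qed.

(** An element outside [m] is a unit: completeness corrects an inverse modulo [m] to an inverse. *)
Lemma prime_sub_max Q x : is_prime_ideal Q -> Q x -> m x.
Proof.
case=> idQ Q1 _ Qx; apply: contrapT => mx; have [y piy] := pi_surj (pi x)^-1.
have [|l xyl] := @sub1_invertible _ _ idm complete_m (1 - x * y).
  apply/pi_ker; rewrite rmorphB rmorph1 rmorphM /= piy divff ?subrr //.
  by apply/eqP => /pi_ker.
by apply: Q1; rewrite -xyl subKr -mulrA; apply: idealMr.
Qed.

Lemma minimal_primes_nil x : (forall i, P i x) -> exists e, x ^+ e = 0.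
Proof.
move=> Px; apply: contrapT => nilx.
have [|Q minQ Qx] := @minimal_prime_avoiding _ x.
  by move=> e; apply/eqP => xe; apply: nilx; exists e.
by have [i QP] := allP minQ; apply/Qx/QP.
Qed.

Lemma radical_sum_sub F x : radical (ideal_sum P F) x -> m x.
Proof.
case=> e Fxe; apply: (@prime_exp _ _ _ e max_prime).
by apply: ideal_sum_sub Fxe => // i y _; apply: prime_sub_max.
Qed.

(** The radical of the sum always lies in [m], so a nonempty face is certified by one element [f] of
    [m] outside that radical. *)
Lemma DeltaP F :
  Delta m P F <-> F = set0 \/ exists f, m f /\ ~ radical (ideal_sum P F) f.
Proof.
split=> -[->|]; try by left.
  move=> neq; right; apply: contrapT => rad; apply: neq => x; split.
    exact: radical_sum_sub.
  by move=> mx; apply: contrapT => radx; apply: rad; exists x.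
by case=> f [mf radf]; right=> /(_ f)[_ /(_ mf)].
Qed.

Lemma radical_sumS F G x :
  F \subset G -> radical (ideal_sum P F) x -> radical (ideal_sum P G) x.
Proof.
move=> /subsetP sFG [e Fx]; exists e; apply: ideal_sum_sub Fx => // i y Fi.
by apply: ideal_sum_mem => //; apply: sFG.
Qed.

Lemma DeltaS F G : F \subset G -> Delta m P G -> Delta m P F.
Proof.
move=> sFG /DeltaP[G0|[f [mf radf]]]; apply/DeltaP.
  by left; apply/eqP; rewrite -subset0 -G0.
by right; exists f; split=> // /(radical_sumS sFG).
Qed.

(** For such a pair [(S, g)], the open set where [g] is invertible lies in [U_S]. *)
Definition face_section (q : {set 'I_n} * R) :=
  Delta m P q.1 /\ forall i, i \notin q.1 -> P i q.2.

(* The punctured spectrum is covered by the complements of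
   [\bigcup_(i notin S) V(P_i)], [S] a face: expand the product over the
   nonfaces [T] of expressions of powers of [f] as elements of [\sum_(i in T) P_i]. *)
Lemma face_cover f : m f -> exists (L : seq ({set 'I_n} * R)) N,
  (forall q, q \in L -> face_section q) /\ f ^+ N = \sum_(q <- L) q.2.
Proof.
move=> mf.
(* Choice functions need a default vertex; without vertices the empty face with section [1] is a
   cover. *)
case: (posnP n) => [n0|n_gt0].
  have noI (i : 'I_n) : False by move: (ltn_ord i); rewrite {2}n0.
  exists [:: (set0, 1)], 0%N; split; last by rewrite big_seq1 expr0.
  move=> q; rewrite inE => /eqP->; split; first by left.
  by move=> i; case: (noI i).
pose nonface T := `[< ~ Delta m P T >].
have expand T : exists e (h : 'I_n -> R), nonface T ->
    (forall i, i \in T -> P i (h i)) /\ f ^+ e = \sum_(i in T) h i.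
  have [/asboolP nfT | ?] := boolP (nonface T); last by exists 0%N, (fun=> 0).
  have [e [h Ph]] : radical (ideal_sum P T) f.
    by apply: contrapT => radf; apply/nfT/DeltaP; right; exists f.
  by exists e, h.
have /fin_all_exists[e /fin_all_exists[h hP]] := expand.
pose choices := pfamily (Ordinal n_gt0) nonface (fun T => mem T).
(* A term of the expansion picks a vertex [phi T] in each nonface [T]; its face consists of the
   vertices never picked. *)
pose face (phi : {ffun {set 'I_n} -> 'I_n}) :=
  [set i | ~~ [exists T, nonface T && (phi T == i)]].
pose term (phi : {ffun {set 'I_n} -> 'I_n}) := \prod_(T | nonface T) h T (phi T).
exists [seq (face phi, term phi) | phi <- enum choices], (\sum_(T | nonface T) e T)%N.
split; last first.
  rewrite -prodrXr big_map big_enum_cond /=.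
  rewrite (eq_bigr (fun T => \sum_(i in T) h T i)) => [|T nfT]; last by have [] := hP T nfT.
  by rewrite (big_distr_big_dep (Ordinal n_gt0)); apply: eq_bigl => phi; rewrite andbT.
move=> _ /mapP[phi + ->]; rewrite mem_enum => /pfamilyP[_ phiT].
split=> /= [|i].
  (* If this set were a nonface, [phi] would pick one of its own vertices. *)
  apply: contrapT => nf; have nfF : nonface (face phi) by apply/asboolP.
  by have := phiT _ nfF; rewrite inE => /existsPn/(_ (face phi)); rewrite nfF eqxx.
rewrite inE negbK => /existsP[T /andP[nfT /eqP <-]].
rewrite /term (bigD1 T) //=; apply: idealMr => //.
by have [Ph _] := hP T nfT; apply/Ph/phiT.
Qed.

Lemma face_cover_seq (fs : seq R) : (forall f, f \in fs -> m f) ->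
  exists (L : seq ({set 'I_n} * R)), (forall q, q \in L -> face_section q) /\
  forall f I, f \in fs -> is_ideal I -> (forall q, q \in L -> I q.2) -> radical I f.
Proof.
elim: fs => [|f fs IHfs] mfs; first by exists [::]; split.
have [g gfs|L [faceL spanL]] := IHfs; first by apply: mfs; rewrite inE gfs orbT.
have [|L' [N [faceL' defL']]] := @face_cover f; first by apply: mfs; rewrite mem_head.
exists (L' ++ L); split=> [q|g I].
  by rewrite mem_cat => /orP[/faceL'|/faceL].
rewrite inE => /orP[/eqP->|gfs] idI IL.
  exists N; rewrite defL' big_seq; apply: ideal_bigsum => // q L'q.
  by apply: IL; rewrite mem_cat L'q.
by apply: spanL => // q Lq; apply: IL; rewrite mem_cat Lq orbT.
Qed.

(** When faces have no common vertex, the product of their sections lies in every minimal prime,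
    hence is nilpotent. Replacing all sections by a common Frobenius power makes these products zero
    and keeps the radical of their span. *)
Lemma face_family (fs : seq R) : (forall f, f \in fs -> m f) ->
  exists (A : finType) (S : A -> {set 'I_n}) (g : A -> R),
  [/\ forall a, Delta m P (S a), forall a i, i \notin S a -> P i (g a),
      forall a b, S a :&: S b = set0 -> g a * g b = 0,
      forall a b d, S a :&: S b :&: S d = set0 -> g a * g b * g d = 0 &
      forall f, f \in fs -> radical (span g) f].
Proof.
move=> /face_cover_seq[L [faceL spanL]].
pose S (a : 'I_(size L)) := (tnth (in_tuple L) a).1.
pose g (a : 'I_(size L)) := (tnth (in_tuple L) a).2.
have faceS a : Delta m P (S a) by case: (faceL _ (mem_tnth a (in_tuple L))).
have gP a i : i \notin S a -> P i (g a).
  by case: (faceL _ (mem_tnth a (in_tuple L))) => _; apply.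
have nil2 (ab : 'I_(size L) * 'I_(size L)) : exists e,
    S ab.1 :&: S ab.2 = set0 -> (g ab.1 * g ab.2) ^+ e = 0.
  case: ab => a b /=; have [S0|neS] := eqVneq (S a :&: S b) set0; last first.
    by exists 0%N => S0; rewrite S0 eqxx in neS.
  have [i|e] := @minimal_primes_nil (g a * g b); last by exists e.
  have /negbT : i \in S a :&: S b = false by rewrite S0 inE.
  rewrite inE negb_and => /orP[] /gP; first exact: idealMr.
  exact: idealMl.
have nil3 (abd : 'I_(size L) * 'I_(size L) * 'I_(size L)) : exists e,
    S abd.1.1 :&: S abd.1.2 :&: S abd.2 = set0 ->
    (g abd.1.1 * g abd.1.2 * g abd.2) ^+ e = 0.
  case: abd => [[a b] d] /=.
  have [S0|neS] := eqVneq (S a :&: S b :&: S d) set0; last first.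
    by exists 0%N => S0; rewrite S0 eqxx in neS.
  have [i|e] := @minimal_primes_nil (g a * g b * g d); last by exists e.
  have /negbT : i \in S a :&: S b :&: S d = false by rewrite S0 inE.
  rewrite !inE !negb_and -orbA => /or3P[] /gP Pg.
  - by rewrite -mulrA; apply: idealMr.
  - by rewrite mulrAC; apply: idealMl.
  - exact: idealMl.
have [e2 /= e2P] := fin_all_exists nil2; have [e3 /= e3P] := fin_all_exists nil3.
have [d2 le2] := expn_dominates pcharR e2; have [d3 le3] := expn_dominates pcharR e3.
exists 'I_(size L), S, (fun a => g a ^+ (p ^ (d2 + d3))); split=> //.
- move=> a i /gP; rewrite -(prednK (_ : 0 < p ^ (d2 + d3)))%N ?expn_gt0 ?prime_gt0 //.
  by rewrite exprS; apply: idealMr.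
- move=> a b Sab; rewrite -exprMn; apply: (ideal_exp (@ideal_zero R)) (e2P (a, b) Sab).
  by apply: leq_trans (le2 _) _; rewrite leq_exp2l ?prime_gt1 ?leq_addr.
- move=> a b d Sabd; rewrite -!exprMn.
  apply: (ideal_exp (@ideal_zero R)) (e3P (a, b, d) Sabd).
  by apply: leq_trans (le3 _) _; rewrite leq_exp2l ?prime_gt1 ?leq_addl.
- move=> f fsf; have [|q Lq|e] := spanL f (span g) fsf; first exact: span_ideal.
    have lt_q : (index q L < size L)%N by rewrite index_mem.
    have <- : g (Ordinal lt_q) = q.2 by rewrite /g (tnth_nth q) /= nth_index.
    exact: span_mem.
  move=> /(span_exp_pchar pcharR (d2 + d3)) spanf.
  by exists (e * p ^ (d2 + d3))%N; rewrite exprM.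
Qed.

Lemma Delta_H0 (t : 'I_n -> 'F_p) :
    (forall i j, Delta m P [set i; j] -> t i = t j) ->
  exists c, forall i, Delta m P [set i] -> t i = c.
Proof.
move=> t_edge; have [x [y [z [mx my mz reg]]]] := depth_ge3 depthR.
(* Adding these [f] to the elements covered ensures that some section is nonzero modulo [P i]. *)
have vtx i : exists f, m f /\ (Delta m P [set i] -> ~ P i f).
  have [/DeltaP[/setP/(_ i)|[f [mf radf]]]|nv] := EM (Delta m P [set i]).
  - by rewrite !inE eqxx.
  - exists f; split=> // _ Pf; apply: radf; exists 1%N.
    by apply: (@ideal_sum_mem _ _ _ _ i) => //; rewrite inE.
  - by exists 0; split=> //; apply: ideal0.
have [f fP] := fin_all_exists vtx.
have [|A [S [g [faceS gP g2 _ spang]]]] := @face_family [:: x, y & codom f].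
  by move=> h; rewrite !inE => /or3P[/eqP->|/eqP->|/codomP[i ->]] //; case: (fP i).
(* The value of [t] on the face [S a]. If [S a] is empty, [g a] kills every section by [g2], so the
   default is harmless. *)
pose tau a := if [pick i in S a] is Some i then t i else 0.
have tauP a i : i \in S a -> t i = tau a.
  rewrite /tau; case: pickP => [j Sj Si|/(_ i) -> //].
  by apply/t_edge/(DeltaS _ (faceS a))/subsetP => h; rewrite !inE => /orP[] /eqP->.
have [|ex spanX] := spang x; first by rewrite mem_head.
have [|ey spanY] := spang y; first by rewrite !inE eqxx orbT.
have [nzX nzY _] := reg3_exp ex ey 1 reg.
have [||r rP] := @cech_H0 _ _ _ (fun a => iota (tau a) * g a) g _ _
    (@ideal_zero R) spanX spanY nzX.
- move=> u v /eqP; rewrite subr_eq0 => /eqP/nzY[w ->].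
  by exists w; rewrite subrr.
- move=> a b; have [S0|[i]] := set_0Vmem (S a :&: S b).
    have -> : iota (tau a) * g a * g b - iota (tau b) * g b * g a =
      (iota (tau a) - iota (tau b)) * (g a * g b) by ring.
    by rewrite g2 ?mulr0.
  by rewrite inE => /andP[/tauP <- /tauP <-]; ring.
have rg a e : r ^+ e * g a = iota (tau a) ^+ e * g a.
  elim: e => [|e IHe] //; rewrite !exprSr -!mulrA.
  have /eqP := rP a; rewrite subr_eq0 => /eqP <-.
  by rewrite mulrCA IHe; ring.
have rp : r ^+ p = r.
  apply/eqP; rewrite -subr_eq0; apply/eqP/nzX.
  have [d ->] := spanX; rewrite mulr_suml big1 // => a _.
  have -> : d a * g a * (r ^+ p - r) = d a * (r ^+ p * g a - r * g a) by ring.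
  have := rg a 1; rewrite !expr1 rg (rmorph_Fp_exp pcharR) => ->.
  by rewrite subrr mulr0.
have [|c] := @prime_Fp_ratio _ _ pcharR iota m r 1 max_prime.
  by rewrite expr1n mulr1 rp subrr; apply: ideal0.
(* The difference [r - iota c] lies in [m] and is fixed by Frobenius, so it lies in every power of
   [m]. *)
rewrite mulr1 => mrc; have rc : r = iota c.
  apply/eqP; rewrite -subr_eq0; apply/eqP/(ideal_pow_separated complete_m) => j.
  have -> : r - iota c = (r - iota c) ^+ (p ^ j).
    elim: j => [|j IHj]; first by rewrite expr1.
    rewrite expnS exprM; have := exprB_pchar pcharR r (iota c) 1.
    by rewrite expn1 rp (rmorph_Fp_exp pcharR) => ->.
  apply: ideal_pow_exp => //; exact: ltnW (ltn_expl _ (prime_gt1 p_pr)).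
exists c => i vi; have [mf /(_ vi) Pf] := fP i.
have [a Pga] : exists a, ~ P i (g a).
  apply: contrapT => noga; apply: Pf.
  have [|e [d fe]] := spang (f i); first by rewrite !inE codom_f !orbT.
  apply: (prime_exp (primeP i) (e := e)); rewrite fe.
  apply: ideal_bigsum => // a _; apply: idealMl => //.
  by apply: contrapT => Pga; apply: noga; exists a.
have Si : i \in S a by apply: contra_notT Pga => /gP.
rewrite (tauP a i Si); apply/eqP; rewrite -subr_eq0; apply: contra_notT Pga.
move=> nz; apply: (ideal_Fp_scale (iota := iota) (idP i) nz).
rewrite rmorphB mulrBl -rc rP.
exact: ideal0.
Qed.

Lemma Delta_H1 (a : 'I_n -> 'I_n -> 'F_p) :
    (forall i j l F, Delta m P F -> i \in F -> j \in F -> l \in F -> a i j + a j l = a i l) ->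
  exists t : 'I_n -> 'F_p, forall i j, Delta m P [set i; j] -> a i j = t i - t j.
Proof.
move=> cocy; have [x [y [z [mx my mz reg]]]] := depth_ge3 depthR.
have edge (ij : 'I_n * 'I_n) : exists f, m f /\
    (Delta m P [set ij.1; ij.2] -> ~ radical (ideal_sum P [set ij.1; ij.2]) f).
  case: ij => i j /=.
  have [/DeltaP[/setP/(_ i)|[f [mf radf]]]|nv] := EM (Delta m P [set i; j]).
  - by rewrite !inE eqxx.
  - by exists f.
  - by exists 0; split=> //; apply: ideal0.
have [f fP] := fin_all_exists edge.
have [|A [S [g [faceS gP _ g3 spang]]]] := @face_family [:: x, y, z & codom f].
  move=> h; rewrite !inE => /or4P[/eqP->|/eqP->|/eqP->|/codomP[i ->]] //.
  by case: (fP i).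
(* [b d] is a potential for [a] on the face [S d], relative to a chosen base vertex. *)
pose b d i := if [pick j in S d] is Some j then a i j else 0.
have bP d i j : i \in S d -> j \in S d -> b d i - b d j = a i j.
  rewrite /b; case: pickP => [l Sl Si Sj|/(_ i) -> //].
  by rewrite -(cocy i j l _ (faceS d)) // addrK.
(* Two potentials differ by a constant on a common face; these constants form the Cech cocycle. *)
pose c d e := if [pick i in S d :&: S e] is Some i then b d i - b e i else 0.
have cP d e i : i \in S d -> i \in S e -> c d e = b d i - b e i.
  rewrite /c => Sdi Sei; case: pickP => [j|/(_ i)]; last by rewrite inE Sdi Sei.
  rewrite inE => /andP[Sdj Sej]; apply/eqP; rewrite -subr_eq0.
  have -> : b d j - b e j - (b d i - b e i) = (b d j - b d i) - (b e j - b e i) by ring.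
  by rewrite !bP // subrr.
have [|ex spanX] := spang x; first by rewrite mem_head.
have [|ey spanY] := spang y; first by rewrite !inE eqxx orbT.
have [|ez spanZ] := spang z; first by rewrite !inE eqxx !orbT.
have [|u uP] := @cech_H1 _ _ (fun d e => iota (c d e)) g _ _ _
  (reg3_exp ex ey ez reg) spanX spanY spanZ.
  move=> d e h; have [S0|[i]] := set_0Vmem (S d :&: S e :&: S h).
    by rewrite g3 ?mul0r.
  rewrite !inE -andbA => /and3P[Sd Se Sh].
  rewrite (cP d e i) // (cP e h i) // (cP d h i) // -rmorphD -rmorphB.
  have -> : b d i - b e i + (b e i - b h i) - (b d i - b h i) = 0 by ring.
  by rewrite rmorph0 mulr0.
have p_gt0 := prime_gt0 p_pr.
have expp (w : R) : w ^+ p = w * w ^+ p.-1 by rewrite -exprS prednK.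
have frob (v w : R) : (v - w) ^+ p = v ^+ p - w ^+ p.
  by have := exprB_pchar pcharR v w 1; rewrite expn1.
have [nzX nzY _] := reg3_exp (ex * p) (ey * p) 1 reg.
have := span_exp_pchar pcharR 1 spanX; have := span_exp_pchar pcharR 1 spanY.
rewrite expn1 -!exprM => spanYp spanXp.
(* With [h = u d / g d], this is [h^p - h] over the denominator [g d ^+ p]. *)
have [||r rP] := @cech_H0 _ _ _ (fun d => u d ^+ p - u d * g d ^+ p.-1)
   (fun d => g d ^+ p) _ _ (@ideal_zero R) spanXp spanYp nzX.
- move=> v w /eqP; rewrite subr_eq0 => /eqP/nzY[h ->].
  by exists h; rewrite subrr.
- move=> d e.
  have -> : (u d ^+ p - u d * g d ^+ p.-1) * g e ^+ p - (u e ^+ p - u e * g e ^+ p.-1) * g d ^+ p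
      = (u d * g e - u e * g d) ^+ p - (u d * g e - u e * g d) * (g d ^+ p.-1 * g e ^+ p.-1).
    by rewrite frob !exprMn !(expp (g _)); ring.
  by rewrite uP !exprMn (rmorph_Fp_exp pcharR) !(expp (g _)); ring.
have [v vP] := artin_schreier idm complete_m pcharR r pi_surj pi_ker sepk.
(* The fraction [w d / g d] is [h - v], a root of [T^p - T]. *)
pose w d := u d - v * g d.
have wP d : w d ^+ p - w d * g d ^+ p.-1 = 0.
  rewrite /w frob exprMn; rewrite -vP in rP; rewrite -[RHS](rP d) !(expp (g _)).
  by ring.
have wg d e : w d * g e - w e * g d = iota (c d e) * g d * g e.
  by rewrite -uP /w; ring.
(* Modulo [P i] the fraction [w d / g d] is a constant in [F_p]; subtracting [b d i] makes it
   independent of [d]. *)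
have coord i : exists t : 'F_p, forall d, ~ P i (g d) -> P i (w d - iota (t + b d i) * g d).
  have [[d0 Pgd0]|noga] := EM (exists d, ~ P i (g d)); last first.
    by exists 0 => d Pgd; case: noga; exists d.
  have [|t0 t0P] := @prime_Fp_ratio _ _ pcharR iota (P i) (w d0) (g d0) (primeP i).
    by rewrite wP; apply: ideal0.
  have inS d : ~ P i (g d) -> i \in S d by move=> Pgd; apply: contra_notT Pgd => /gP.
  exists (t0 - b d0 i) => d Pgd.
  have [_ _ /(_ (g d0) (w d - iota (t0 - b d0 i + b d i) * g d))] := primeP i.
  case=> //; have -> : t0 - b d0 i + b d i = t0 + c d d0.
    by rewrite (cP d d0 i) ?inS //; ring.
  have -> : g d0 * (w d - iota (t0 + c d d0) * g d) = g d * (w d0 - iota t0 * g d0).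
    have -> : g d * (w d0 - iota t0 * g d0) =
      (w d * g d0 - (w d * g d0 - w d0 * g d)) - iota t0 * g d0 * g d by ring.
    by rewrite wg rmorphD; ring.
  exact: idealMl.
have [t tP] := fin_all_exists coord.
exists (fun i => - t i) => i j eij; have [mf /(_ eij) radf] := fP (i, j).
(* On this section the constants found at [P i] and [P j] can be compared modulo [P i + P j]: if
   they differed, their invertible difference times [g d] would put [g d] in the ideal. *)
have [d radg] : exists d, ~ radical (ideal_sum P [set i; j]) (g d).
  apply: contrapT => noga; apply: radf.
  have [|e spanf] := spang (f (i, j)); first by rewrite !inE codom_f !orbT.
  have radg d : radical (ideal_sum P [set i; j]) (g d).
    by apply: contrapT => radg; apply: noga; exists d.
  have [e' fe] := radical_span pcharR (idsum _) radg spanf.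
  by exists (e * e')%N; rewrite exprM.
have inij h : h \in [set i; j] -> h \in S d /\ ideal_sum P [set i; j] (w d - iota (t h + b d h) * g d).
  move=> hij; have Pgh : ~ P h (g d).
    by move=> Pgd; apply: radg; exists 1%N; apply: ideal_sum_mem Pgd.
  split; first by apply: contra_notT Pgh => /gP.
  exact: ideal_sum_mem (tP h d Pgh).
have [Si wi] := inij i (set21 i j); have [Sj wj] := inij j (set22 i j).
rewrite -(bP d i j Si Sj) opprK; apply/eqP; rewrite -subr_eq0.
apply: contra_notT radg => nz; exists 1%N.
apply: (ideal_Fp_scale (iota := iota) (idsum _) nz).
have -> : b d i - b d j - (- t i + t j) = (t i + b d i) - (t j + b d j) by ring.
rewrite rmorphB.
have -> : (iota (t i + b d i) - iota (t j + b d j)) * g d =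
  (w d - iota (t j + b d j) * g d) - (w d - iota (t i + b d i) * g d) by ring.
exact: idealB.
Qed.

End DualComplex.

(** * Simplicial homology and cohomology *)

Section Homology.
Variable n : nat.
Implicit Types (F G T : {set 'I_n}) (v i j l : 'I_n).

Definition vsign (A : pzRingType) v G : A := (-1) ^+ #|[set i in G | (i < v)%N]|.

(** The matrix of [boundary]; the sum has one term if [F] is [G] with a vertex added, and none
    otherwise. The ring is a parameter so that the matrix can be transported from [F_p] to [k]. *)
Definition incidence (A : pzRingType) F G : A :=
  \sum_(v | (v \notin G) && (F == v |: G)) vsign A v G.

Lemma boundaryE (k : fieldType) (c : {ffun {set 'I_n} -> k}) G :
  boundary c G = \sum_F c F * incidence k F G.
Proof.
rewrite ffunE; under [RHS]eq_bigr do rewrite mulr_sumr.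
rewrite (exchange_big_dep (fun v => v \notin G)) /=; last by move=> F v _ /andP[].
apply: eq_big => [v|v vG]; first by rewrite inE.
rewrite (big_pred1 (v |: G)) => [|F]; first by rewrite /vsign mulrC.
by move: vG; rewrite inE => ->.
Qed.

Lemma coboundaryE (A : comPzRingType) (phi : {set 'I_n} -> A) F :
  \sum_G incidence A F G * phi G = \sum_(v in F) vsign A v (F :\ v) * phi (F :\ v).
Proof.
under eq_bigr do rewrite mulr_suml.
rewrite (exchange_big_dep (fun v => v \in F)) /=; last first.
  by move=> G v _ /andP[_ /eqP->]; rewrite setU11.
apply: eq_bigr => v Fv; rewrite (big_pred1 (F :\ v)) // => G.
apply/andP/eqP => [[Gv /eqP->]|->]; first by rewrite setU1K.
by rewrite setD11 setD1K.
Qed.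

Lemma rmorph_incidence (A B : pzRingType) (f : {rmorphism A -> B}) F G :
  f (incidence A F G) = incidence B F G.
Proof. by rewrite rmorph_sum; apply: eq_bigr => v _; rewrite rmorphXn rmorphN rmorph1. Qed.

Lemma coboundary1 (A : comPzRingType) (phi : {set 'I_n} -> A) i :
  \sum_G incidence A [set i] G * phi G = phi set0.
Proof.
rewrite coboundaryE big_set1 setDv /vsign.
have -> : [set h : 'I_n in set0 | (h < i)%N] = set0 :> {set 'I_n} by apply/setP => h; rewrite !inE.
by rewrite cards0 expr0 mul1r.
Qed.

Lemma coboundary2 (A : comPzRingType) (phi : {set 'I_n} -> A) i j :
  (i < j)%N -> \sum_G incidence A [set i; j] G * phi G = phi [set j] - phi [set i].
Proof.
move=> ltij; rewrite coboundaryE big_setU1 ?big_set1; last first.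
  by rewrite inE -val_eqE /=; lia.
have -> : [set i; j] :\ i = [set j].
  by apply/setP => h; rewrite !inE -!val_eqE /=; lia.
have -> : [set i; j] :\ j = [set i].
  by apply/setP => h; rewrite !inE -!val_eqE /=; lia.
rewrite /vsign.
have -> : [set h in [set j] | (h < i)%N] = set0.
  by apply/setP => h; rewrite !inE -!val_eqE /=; lia.
have -> : [set h in [set i] | (h < j)%N] = [set i].
  by apply/setP => h; rewrite !inE -!val_eqE /=; lia.
by rewrite cards0 cards1 expr0 expr1 mul1r mulN1r.
Qed.

Lemma coboundary3 (A : comPzRingType) (phi : {set 'I_n} -> A) i j l :
    (i < j)%N -> (j < l)%N ->
  \sum_G incidence A [set i; j; l] G * phi G =
    phi [set j; l] - phi [set i; l] + phi [set i; j].
Proof.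
move=> ltij ltjl; rewrite coboundaryE -setUA !big_setU1 ?big_set1; last 2 first.
- by rewrite !inE -!val_eqE /=; lia.
- by rewrite !inE -!val_eqE /=; lia.
have -> : (i |: [set j; l]) :\ i = [set j; l].
  by apply/setP => h; rewrite !inE -!val_eqE /=; lia.
have -> : (i |: [set j; l]) :\ j = [set i; l].
  by apply/setP => h; rewrite !inE -!val_eqE /=; lia.
have -> : (i |: [set j; l]) :\ l = [set i; j].
  by apply/setP => h; rewrite !inE -!val_eqE /=; lia.
rewrite /vsign.
have -> : [set h in [set j; l] | (h < i)%N] = set0.
  by apply/setP => h; rewrite !inE -!val_eqE /=; lia.
have -> : [set h in [set i; l] | (h < j)%N] = [set i].
  by apply/setP => h; rewrite !inE -!val_eqE /=; lia.
have -> : [set h in [set i; j] | (h < l)%N] = [set i; j].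
  by apply/setP => h; rewrite !inE -!val_eqE /=; lia.
rewrite cards0 cards1 cards2.
have -> : i != j by rewrite -val_eqE /=; lia.
by rewrite expr0 expr1 sqrrN expr1n !mul1r mulN1r /= addrA.
Qed.

Lemma cards2_ordered F : #|F| = 2 -> exists i j, (i < j)%N /\ F = [set i; j].
Proof.
move/eqP/cards2P=> [i [j [neij ->]]].
have [ltij|ltji|/val_inj eqij] := ltngtP i j.
- by exists i, j.
- by exists j, i; rewrite setUC.
- by rewrite eqij eqxx in neij.
Qed.

(* Ranks of matrices do not change under extension of scalars, so exactness of
   the cochain complex over [f0] yields exactness of the chain complex over [k]. *)
Lemma reduced_homology_zero_dual (f0 k : fieldType) (f : {rmorphism f0 -> k})
    (K : {set 'I_n} -> Prop) (d : nat) :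
    (forall phi : {set 'I_n} -> f0,
       (forall F, K F -> #|F| = d.+2 -> \sum_G incidence f0 F G * phi G = 0) ->
     exists psi : {set 'I_n} -> f0,
       forall F, K F -> #|F| = d.+1 -> phi F = \sum_G incidence f0 F G * psi G) ->
  reduced_homology_zero k K d.
Proof.
move=> exact_f0 c chain_c bd_c.
pose N := #|{set 'I_n}|; pose cell e F := `[< K F >] && (#|F| == e).
have sumN (A : pzRingType) (h : {set 'I_n} -> A) : \sum_F h F = \sum_(a < N) h (enum_val a).
  exact: reindex (onW_bij _ (@enum_val_bij _)).
have cellP e F : reflect (K F /\ #|F| = e) (cell e F).
  by apply: (iffP andP) => [[/asboolP ? /eqP]|[/asboolP ? /eqP]].
pose E : 'M[f0]_N := diag_mx (\row_a (cell d.+1 (enum_val a))%:R).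
pose B e : 'M[f0]_N :=
  \matrix_(a, b) ((cell e (enum_val a))%:R * incidence f0 (enum_val a) (enum_val b)).
(* The columns of [C] span the cocycles, so exactness factors [E *m C] through [B d.+1]. *)
have [C CE] : exists C, C = cokermx (B d.+2) by eexists.
have lift b : exists w : 'cV[f0]_N, col b (E *m C) = B d.+1 *m w.
  have [|psi psiP] := exact_f0 (fun F => C (enum_rank F) b).
    move=> F KF cardF; have /matrixP/(_ (enum_rank F) b) 
      := mulmx_coker (B d.+2).
    rewrite -CE 2!mxE sumN => coker0; rewrite -[RHS]coker0; apply: eq_bigr => a _.
    have cellF : cell d.+2 F by apply/cellP.
    by rewrite !mxE enum_rankK enum_valK cellF mul1r.
  exists (\col_a psi (enum_val a)); apply/matrixP => a o; rewrite mul_diag_mx !mxE.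
  under eq_bigr do rewrite !mxE.
  have [/cellP[KF cardF]|_] := boolP (cell d.+1 (enum_val a)); last first.
    by rewrite mul0r big1 // => a' _; rewrite !mul0r.
  have := psiP _ KF cardF; rewrite enum_valK => ->; rewrite mul1r sumN.
  by apply: eq_bigr => a' _; rewrite mul1r.
have [w wP] := fin_all_exists lift.
have EC : E *m C = B d.+1 *m \matrix_(a, b) w b a ord0.
  apply/matrixP => a b; have /matrixP/(_ a ord0) := wP b; rewrite mxE => ->.
  by rewrite !mxE; apply: eq_bigr => a' _; rewrite !mxE.
pose cv : 'rV[k]_N := \row_a c (enum_val a).
have cvE : cv *m map_mx f E = cv.
  rewrite map_diag_mx mul_mx_diag; apply/rowP => a; rewrite !mxE rmorph_nat.
  have [ca0|/chain_c/cellP->] := eqVneq (c (enum_val a)) 0; last by rewrite mulr1.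
  by rewrite ca0 mul0r.
have cvB : cv *m map_mx f (B d.+1) = 0.
  apply/rowP => b; have /ffunP/(_ (enum_val b)) := bd_c.
  rewrite boundaryE sumN [RHS]ffunE => bd0; rewrite [RHS]mxE -[RHS]bd0 mxE.
  apply: eq_bigr => a _; rewrite !mxE rmorphM rmorph_nat rmorph_incidence.
  have [ca0|/chain_c/cellP->] := eqVneq (c (enum_val a)) 0; last by rewrite mul1r.
  by rewrite ca0 !mul0r.
(* A cycle pairs to zero with coboundaries, hence with all columns of [C]. As [cokermx] commutes
   with [f], this puts the cycle in the row space of [B d.+2]. *)
have /submxP[dv cvD] : (cv <= map_mx f (B d.+2))%MS.
  by rewrite submxE -map_cokermx -CE -cvE -mulmxA -map_mxM EC map_mxM mulmxA cvB mul0mx.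
exists [ffun F => (cell d.+2 F)%:R * dv ord0 (enum_rank F)]; split.
  move=> F; rewrite ffunE; apply: contra_neqP => /cellP/negPf->.
  by rewrite mul0r.
apply/ffunP => G; rewrite boundaryE sumN.
have /rowP/(_ (enum_rank G)) := cvD; rewrite !mxE enum_rankK => ->.
apply: eq_bigr => a _.
by rewrite ffunE !mxE enum_valK enum_rankK rmorphM rmorph_nat rmorph_incidence mulrCA mulrA.
Qed.

(** * Antisymmetric cocycles on ordered pairs of vertices *)

Section EdgeCocycles.
Variables (A : comPzRingType) (phi : {set 'I_n} -> A) (K : {set 'I_n} -> Prop).
Hypothesis KS : forall F G, F \subset G -> K G -> K F.
Hypothesis cocycle_phi :
  forall F, K F -> #|F| = 3 -> \sum_G incidence A F G * phi G = 0.

Definition oriented_edge i j : A :=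
  if (i < j)%N then phi [set i; j] else if (j < i)%N then - phi [set i; j] else 0.

(** For increasing vertices this is the cocycle identity on a triangle; antisymmetry gives the other
    orders and the degenerate triples. *)
Lemma oriented_edgeD i j l F : K F -> i \in F -> j \in F -> l \in F ->
  oriented_edge i j + oriented_edge j l = oriented_edge i l.
Proof.
have key x y z : K F -> x \in F -> y \in F -> z \in F -> (x < y)%N -> (y < z)%N ->
    phi [set x; z] = phi [set x; y] + phi [set y; z].
  move=> KF Fx Fy Fz ltxy ltyz; apply/eqP; rewrite -subr_eq0; apply/eqP.
  have := cocycle_phi (F := [set x; y; z]); rewrite coboundary3 // => H.
  rewrite -[RHS]oppr0 -H; first by ring.
    by apply: KS KF; apply/subsetP => h; rewrite !inE -orbA => /or3P[] /eqP->.
  have xy : (x == y) = false by rewrite -val_eqE /=; lia.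
  rewrite setUC cardsU1 cards2 xy !inE.
  have -> : (z == x) = false by rewrite -val_eqE /=; lia.
  by have -> : (z == y) = false by rewrite -val_eqE /=; lia.
have sym x y : phi [set x; y] = phi [set y; x] by rewrite setUC.
move=> KF Fi Fj Fl; rewrite /oriented_edge.
have [ij|ji|/val_inj<-] := ltngtP i j; last by rewrite add0r.
  have [jl|lj|/val_inj<-] := ltngtP j l; last by rewrite ij addr0.
    by rewrite (ltn_trans ij jl) (key i j l).
  have [il|li|/val_inj<-] := ltngtP i l.
  - by rewrite (key i l j) // (sym j l); ring.
  - by rewrite (sym j l) (sym i l) (key l i j) //; ring.
  - by rewrite (sym j i) subrr.
have [jl|lj|/val_inj<-] := ltngtP j l.
- have [il|li|/val_inj<-] := ltngtP i l.
  + by rewrite (key j i l) // (sym i j); ring.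
  + by rewrite (sym i l) (sym i j) (key j l i) //; ring.
  + by rewrite (sym i j) addNr.
- rewrite ltnNge (ltnW (ltn_trans lj ji)) /= (ltn_trans lj ji).
  by rewrite (sym i l) (sym i j) (sym j l) (key l j i) //; ring.
- by rewrite addr0 ltnNge (ltnW ji) /= ji.
Qed.

End EdgeCocycles.
End Homology.

(** * From cohomology over [F_p] to homology over the residue field *)

Theorem theorem1p2
  (R : comNzRingType) (m : R -> Prop) (p : nat)
  (n : nat) (P : 'I_n -> R -> Prop)
  (k : fieldType) (pi : {rmorphism R -> k}) :
  noetherian R ->
  is_local_with m ->
  madic_complete m ->
  p \in [pchar R] ->
  (* P enumerates the minimal primes of R, without repetition *)
  (forall i, is_minimal_prime (P i)) ->
  (forall i j, same_set (P i) (P j) -> i = j) ->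
  (forall Q, is_minimal_prime Q -> exists i, same_set Q (P i)) ->
  (* k is the residue field R/m via pi *)
  (forall y : k, exists x, pi x = y) ->
  (forall x, pi x = 0 <-> m x) ->
  separably_closed k ->
  depth_ge m 3 ->
  reduced_homology_zero k (Delta m P) 0 /\ reduced_homology_zero k (Delta m P) 1.
Proof.
move=> _ [[idm _ _] _] complete_m pcharR minP _ allP pi_surj pi_ker sepk depthR.
pose iota : {rmorphism 'F_p -> R} := 
  (GRing.in_alg (pPrimeCharType pcharR) : {rmorphism 'F_p -> pPrimeCharType pcharR}).
pose iotak : {rmorphism 'F_p -> k} := pi \o iota.
have DS (F G : {set 'I_n}) : F \subset G -> Delta m P G -> Delta m P F.
  exact: (DeltaS idm complete_m pi_surj pi_ker minP).
split; apply: (reduced_homology_zero_dual iotak) => phi cocycle_phi.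
- have edgeE (i j : 'I_n) : (i < j)%N -> Delta m P [set i; j] -> phi [set i] = phi [set j].
    move=> ltij Dij; have := cocycle_phi _ Dij; rewrite coboundary2 // cards2.
    rewrite -val_eqE /= neq_ltn ltij => /(_ erefl)/eqP.
    by rewrite subr_eq0 => /eqP.
  have [|c cP] := @Delta_H0 _ _ _ _ _ _ _ iota pcharR idm complete_m pi_surj pi_ker
      minP allP depthR (fun i => phi [set i]).
    move=> i j Dij; have [ltij|ltji|/val_inj-> //] := ltngtP i j; first exact: edgeE.
    by apply/esym/edgeE; rewrite 1?setUC.
  (* Only the value at the empty face counts: it is the cochain of degree -1 in the augmented
     complex. *)
  exists (fun=> c) => F DF /eqP/cards1P[i Fi]; rewrite {F}Fi in DF *.
  by rewrite coboundary1 cP.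
- have [|t tP] := @Delta_H1 _ _ _ _ _ _ _ iota pcharR idm complete_m pi_surj pi_ker sepk
      minP allP depthR (oriented_edge phi).
    by move=> i j l F; apply: (oriented_edgeD DS cocycle_phi).
  (* Only singletons count. The sign is needed because the coboundary on an edge takes the larger
     vertex minus the smaller. *)
  exists (fun F : {set 'I_n} => if [pick i in F] is Some i then - t i else 0).
  move=> F DF /cards2_ordered[i [j [ltij Fij]]]; rewrite {F}Fij in DF *.
  rewrite coboundary2 //; have := tP _ _ DF; rewrite /oriented_edge ltij => ->.
  have pick1 (h : 'I_n) : [pick x in [set h]] = Some h.
    by case: pickP => [x|/(_ h)]; rewrite !inE ?eqxx // => /eqP->.
  by rewrite !pick1 opprK addrC.
Qed.
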